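(* Let $X$ be an arbitrary (Tychonoff) $P$-space and let $Y$ be an rr-good weakly Lindelöf (Tychonoff) space. Then the space $X\times Y$ is rr-good.
   Context: All topological spaces are assumed to be Tychonoff. For a space $X$, $\mathrm{C}(X)$ is the ring of continuous real-valued functions on $X$. It is partially ordered by the reduced ring order: $f\le_{\mathrm{rr}} g$ if and only if $f^2=fg$. The space $X$ is called rr-good if every pair $f,g\in \mathrm{C}(X)$ has an infimum (greatest lower bound) in the partial order $\le_{\mathrm{rr}}$. A $P$-space is a space in which every $G_\delta$-set is open. A space $Y$ is weakly Lindelöf if for every open cover $\{U_\alpha\}_{\alpha\in A}$ of $Y$ there is a countable subfamily $\{U_{\alpha_n}\}_{n\in\mathbf{N}}$ with $\bigcup_{n\in\mathbf{N}}U_{\alpha_n}$ dense in $Y$. *)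

(* Defs.v *)
From HB Require Import structures.
From mathcomp Require Import all_boot all_order all_algebra.
From mathcomp Require Import all_classical all_reals all_analysis.
From mathcomp Require Import borel_hierarchy.

Set Implicit Arguments.
Unset Strict Implicit.
Unset Printing Implicit Defensive.

Import Order.TTheory GRing.Theory Num.Theory.
Import numFieldNormedType.Exports.

Local Open Scope classical_set_scope.
Local Open Scope ring_scope.

(* [completely_regular_space] contains no separation axiom. By
   [uniform_separatorP] its uniform separators amount to continuous
   real-valued functions separating points from closed sets. *)
Definition tychonoff_space (T : topologicalType) : Prop :=
  hausdorff_space T /\ completely_regular_space T.

Definition P_space (T : topologicalType) : Prop :=
  forall S : set T, Gdelta S -> open S.

(* The countable subfamily is given by a countable set of indices rather than
   by a sequence, so that it may be finite, or empty when T is. *)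
Definition weakly_lindelof (T : topologicalType) : Prop :=
  forall (I : Type) (U : I -> set T),
    (forall i, open (U i)) -> \bigcup_i U i = setT ->
    exists2 D : set I, countable D & dense (\bigcup_(i in D) U i).

Section reduced_ring_order.
Context {R : realType} {T : topologicalType}.
Implicit Types f g h : continuousType T R.

(* f ^ 2 = f * g in the ring C(T), whose operations are pointwise. *)
Definition rr_le f g : Prop := forall x : T, f x ^+ 2 = f x * g x.

Definition rr_is_inf f g h : Prop :=
  [/\ rr_le h f, rr_le h g
    & forall k : continuousType T R, rr_le k f -> rr_le k g -> rr_le k h].

End reduced_ring_order.

Definition rr_good (R : realType) (T : topologicalType) : Prop :=
  forall f g : continuousType T R,
    exists h : continuousType T R, rr_is_inf f g h.

(* Main.v *)
Require Import Defs.
From HB Require Import structures.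
From mathcomp Require Import all_boot all_order all_algebra.
From mathcomp Require Import all_classical all_reals all_analysis.

(** The relation [f^2 = f g] says that at each point [f] is [0] or equals [g],
    so it is tested fibre by fibre: a lower bound of [f] and [g] on [X * Y]
    restricts to a lower bound on every slice [{x} * Y].  Since [Y] is
    rr-good, the slices of [f] and [g] at [x] have an infimum [h_x], and the
    only candidate worth trying is [h (x, y) = h_x y].  The order-theoretic
    properties of [h] are immediate; the question is its continuity.

    This is where the two topological hypotheses meet.  Near a point [x0], and
    for a given [e > 0], weak Lindelofness covers a dense part of [Y] by
    countably many open sets on each of which [f (x, _)] is [e]-close to
    [f (x0, _)] as soon as [x] is in some neighbourhood of [x0].  In a P-space
    countably many neighbourhoods of [x0] still meet in a neighbourhood, so one
    neighbourhood serves for this dense part, hence (closed inequality) for all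
    of [Y]; intersecting once more over [e = 1/n], the slices of [f] are equal
    to the slice at [x0] for all [x] near [x0].  Thus
    [x |-> f (x, _)] is locally constant ([curry_locally_constant]), and so is
    any [x |-> h_x] that depends only on the slices of [f] and [g]; a function
    on the product with continuous, locally constant slices is continuous
    ([continuous_uncurry_locally_constant]). *)

Set Implicit Arguments.
Unset Strict Implicit.
Unset Printing Implicit Defensive.

Import Order.TTheory GRing.Theory Num.Theory.
Import numFieldNormedType.Exports.

Local Open Scope classical_set_scope.
Local Open Scope ring_scope.

(** Passing to interiors turns the intersection of the neighbourhoods into a
    [Gdelta] set, which is open and still contains [x]. *)
Lemma P_space_near_countable (X : topologicalType) (PX : P_space X)
    (J : Type) (D : set J) (U : J -> set X) (x : X) :
  countable D -> (forall i, D i -> nbhs x (U i)) ->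
  \forall z \near x, forall i, D i -> U i z.
Proof.
move=> /countable_injP[code code_inj] Ux.
(* Indices are replaced by their codes; a number coding nothing in D gives the
   whole space. *)
pose F n := [set z | forall i, D i -> code i = n -> (U i)^° z].
have openF n : open (F n).
  have [[i [Di ci]]|noi] := pselect (exists i, D i /\ code i = n).
    rewrite (_ : F n = (U i)^°); first exact: open_interior.
    apply/seteqP; split=> z /= Fz; first exact: Fz.
    move=> j Dj cj; rewrite (_ : j = i) //.
    by apply: code_inj; rewrite ?inE // cj ci.
  rewrite (_ : F n = setT); first exact: openT.
  by apply/seteqP; split=> z //= _ i Di ci; case: noi; exists i.
have openI : open (\bigcap_n F n) by apply: PX; exists F.
have Ix : (\bigcap_n F n) x by move=> n _ i Di _; exact: Ux.
apply: filterS (open_nbhs_nbhs (conj openI Ix)) => z Fz i Di.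
exact: interior_subset (Fz (code i) I i Di erefl).
Qed.

Section slices.
Context {R : realType} {X Y : topologicalType}.

Lemma slice_continuous (f : continuousType (X * Y)%type R) (x : X) :
  continuous (fun y => f (x, y)).
Proof.
move=> y; apply: (@continuous_comp _ _ _ (pair x) f); last exact: cts_fun.
by apply: cvg_pair; [exact: cvg_cst|exact: cvg_id].
Qed.

Definition slice (f : continuousType (X * Y)%type R) (x : X) :
    continuousType Y R :=
  HB.pack (fun y => f (x, y)) (isContinuous.Build Y R _ (@slice_continuous f x)).

Lemma rr_le_slice (f g : continuousType (X * Y)%type R) :
  rr_le f g <-> forall x, rr_le (slice f x) (slice g x).
Proof. by split=> [fg x y|fg [x y]]; [exact: fg|exact: fg x y]. Qed.

Context (PX : P_space X) (wlY : weakly_lindelof Y).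

(** Weak Lindelofness controls only a dense part of [Y], and the bound extends
    from there because it is a non-strict one between continuous functions. *)
Lemma slice_near (f : continuousType (X * Y)%type R) (x0 : X) (e : R) :
  0 < e -> \forall x \near x0, forall y, `|f (x, y) - f (x0, y)| <= e.
Proof.
move=> e0.
have box y : exists AB : set X * set Y, [/\ nbhs x0 AB.1, open AB.2, AB.2 y &
    forall x z, AB.1 x -> AB.2 z -> `|f (x, z) - f (x0, z)| < e].
  have e20 : 0 < e / 2 by rewrite divr_gt0.
  have /cvgrPdist_lt/(_ _ e20)[[A B] /= [Ax By] AB] := @cts_fun _ _ f (x0, y).
  exists (A, B^°) => /=; split=> //; [exact: open_interior|].
  move=> x z Ax1 /interior_subset Bz.
  have fxz := AB (x, z) (conj Ax1 Bz).
  have f0z := AB (x0, z) (conj (nbhs_singleton Ax) Bz).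
  rewrite (splitr e) (le_lt_trans (ler_distD (f (x0, y)) _ _))// ltrD//.
  by rewrite distrC.
have [AB ABP] := choice box.
have [D Dcount Ddense] : exists2 D : set Y,
    countable D & dense (\bigcup_(y in D) (AB y).2).
  apply: wlY => [y|]; first by case: (ABP y).
  by apply/seteqP; split=> // y _; exists y => //; case: (ABP y).
have Anear y : D y -> nbhs x0 (AB y).1 by case: (ABP y).
apply: filterS (P_space_near_countable PX Dcount Anear) => x Ax y.
rewrite leNgt; apply/negP => ey.
(* The points violating the bound form an open set, which the dense union
   would meet. *)
pose dist z := `|f (x, z) - f (x0, z)|.
have cdist : continuous dist.
  by move=> z; apply: cvg_norm; apply: cvgB; exact: slice_continuous.
have [||z [/= ez [w Dw ABz]]] := Ddense [set z | e < dist z].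
- by exists y.
- apply: (@open_comp _ _ dist [set t | e < t]); last exact: open_gt.
  by move=> z _; exact: cdist.
have [_ _ _ /(_ x z (Ax w Dw) ABz)] := ABP w.
by rewrite ltNge (ltW ez).
Qed.

(** The neighbourhood given by [slice_near] depends on [e], but [e = 1/n]
    leaves only countably many to intersect. *)
Lemma curry_locally_constant (f : continuousType (X * Y)%type R) (x0 : X) :
  \forall x \near x0, slice f x = slice f x0.
Proof.
have near_n n : setT n -> \forall x \near x0,
    forall y, `|f (x, y) - f (x0, y)| <= n.+1%:R^-1.
  by move=> _; apply: slice_near; rewrite invr_gt0.
apply: filterS (P_space_near_countable PX (countableP setT) near_n) => x fx.
apply/continuousEP => y; apply/eqP; rewrite -subr_eq0 -normr_le0 leNgt.
apply/negP => /ltr_add_invr[n]; rewrite add0r ltNge.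
by move/negP; apply; exact: fx.
Qed.

End slices.

Lemma continuous_uncurry_locally_constant (X Y Z : topologicalType)
    (H : X -> continuousType Y Z) :
  (forall x0, \forall x \near x0, H x = H x0) ->
  continuous (fun p : X * Y => H p.1 p.2).
Proof.
move=> Hloc [x0 y0] /= V Vh.
exists ([set x | H x = H x0], H x0 @^-1` V) => /=.
  by split; [exact: Hloc|exact: cts_fun Vh].
by move=> [x y] /= [-> Vy].
Qed.

Theorem theorem2p13 (R : realType) (X Y : topologicalType)
    (tychX : tychonoff_space X) (PX : P_space X)
    (tychY : tychonoff_space Y) (goodY : rr_good R Y)
    (wlY : weakly_lindelof Y) :
  rr_good R (X * Y)%type.
Proof.
move=> f g.
(* Choosing the infimum as a function of the pair of slices, not of the point
   of X, makes it locally constant along with them. *)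
have goodY2 (uv : continuousType Y R * continuousType Y R) :
  exists h, rr_is_inf uv.1 uv.2 h by exact: goodY.
have [inf infP] := choice goodY2.
pose H x := inf (slice f x, slice g x).
have Hloc x0 : \forall x \near x0, H x = H x0.
  have := curry_locally_constant PX wlY f x0.
  apply: filterS2 (curry_locally_constant PX wlY g x0) => x gx fx.
  by rewrite /H fx gx.
pose h : continuousType (X * Y)%type R := HB.pack (fun p : X * Y => H p.1 p.2)
  (isContinuous.Build _ _ _ (continuous_uncurry_locally_constant Hloc)).
exists h; split.
- by move=> [x y]; have [+ _ _] := infP (slice f x, slice g x); exact.
- by move=> [x y]; have [_ + _] := infP (slice f x, slice g x); exact.
- move=> k /rr_le_slice kf /rr_le_slice kg [x y].
  have [_ _ /(_ (slice k x) (kf x) (kg x))] := infP (slice f x, slice g x).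
  exact.
Qed.
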